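(* Let $p(n)$ denote the number of integer partitions of $n$, and let $(a(n))_{n\ge1}$ be the sequence (OEIS A305841) defined by the formal power series identity $$\prod_{n \geq 1}(1+x^n)^{a(n)} = \prod_{n\geq 1} (1-x^n)^{-p(n)}.$$ For $n\ge 1$ let $A(n)$ be the number of types of $n$ having a single multiplicity, which is a power of $2$. Then $A(n)=a(n)$ for all $n\ge1$.
   Context: A type of $n$ is a sequence $\tau=(\tau|^1,\tau|^2,\dots)$ of (possibly empty) integer partitions with $\sum_{i\ge1} i\,|\tau|^i|=n$, where $|\tau|^i|$ is the size of the partition $\tau|^i$; the multiplicities of $\tau$ are the indices $i$ with $\tau|^i$ nonempty. Thus $A(n)$ counts types $\tau$ of $n$ for which there is exactly one $i$ with $\tau|^i\neq\varnothing$, and this $i$ equals $2^k$ for some $k\ge 0$. Equivalently, $A(n)=p(n)+p(n/2)+p(n/4)+\cdots$, where $p(m)=0$ whenever $m$ is not a non-negative integer. *)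

(* Defs.v *)
From HB Require Import structures.
From mathcomp Require Import all_boot all_order all_algebra.
From mathcomp Require Import finmap zify.
From mathcomp Require Import boolp classical_sets functions cardinality fsbigop.

Set Implicit Arguments.
Unset Strict Implicit.
Unset Printing Implicit Defensive.

Import GRing.Theory.
Local Open Scope classical_set_scope.
Local Open Scope ring_scope.

Record fps (R : Type) := Fps { fps_coef : nat -> R }.

HB.instance Definition _ (R : Type) := gen_eqMixin (fps R).
HB.instance Definition _ (R : Type) := gen_choiceMixin (fps R).

Lemma fpsP (R : Type) (f g : fps R) : fps_coef f =1 fps_coef g -> f = g.
Proof. by case: f g => [f] [g] /= /funext ->. Qed.

Definition fps_zero (R : comNzRingType) : fps R := Fps (fun=> 0).
Definition fps_opp (R : comNzRingType) (f : fps R) : fps R :=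
  Fps (fun k => - fps_coef f k).
Definition fps_add (R : comNzRingType) (f g : fps R) : fps R :=
  Fps (fun k => fps_coef f k + fps_coef g k).
Definition fps_one (R : comNzRingType) : fps R := Fps (fun k => (k == 0%N)%:R).
Definition fps_mul (R : comNzRingType) (f g : fps R) : fps R :=
  Fps (fun k => \sum_(i < k.+1) fps_coef f i * fps_coef g (k - i)).

Fact fps_addA (R : comNzRingType) : associative (@fps_add R).
Proof. by move=> f g h; apply: fpsP => k /=; rewrite addrA. Qed.
Fact fps_addC (R : comNzRingType) : commutative (@fps_add R).
Proof. by move=> f g; apply: fpsP => k /=; rewrite addrC. Qed.
Fact fps_add0 (R : comNzRingType) : left_id (fps_zero R) (@fps_add R).
Proof. by move=> f; apply: fpsP => k /=; rewrite add0r. Qed.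
Fact fps_addN (R : comNzRingType) :
  left_inverse (fps_zero R) (@fps_opp R) (@fps_add R).
Proof. by move=> f; apply: fpsP => k /=; rewrite addNr. Qed.

HB.instance Definition _ (R : comNzRingType) :=
  GRing.isZmodule.Build (fps R)
    (@fps_addA R) (@fps_addC R) (@fps_add0 R) (@fps_addN R).

Definition fps_trunc (R : comNzRingType) (m : nat) (f : fps R) : {poly R} :=
  \poly_(i < m) fps_coef f i.

Fact fps_mulE (R : comNzRingType) (f g : fps R) m k : (k < m)%N ->
  fps_coef (fps_mul f g) k = (fps_trunc m f * fps_trunc m g)`_k.
Proof.
move=> km; rewrite coefM /=; apply: eq_bigr => i _; rewrite !coef_poly.
have im : (i < m)%N by apply: leq_trans km; exact: ltn_ord.
by rewrite im (leq_ltn_trans (leq_subr i k) km).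
Qed.

Fact fps_mulC (R : comNzRingType) : commutative (@fps_mul R).
Proof. by move=> f g; apply: fpsP => k; rewrite !(@fps_mulE _ _ _ k.+1) // mulrC. Qed.

Fact fps_mulA (R : comNzRingType) : associative (@fps_mul R).
Proof.
move=> f g h; apply: fpsP => k.
pose t := @fps_trunc R k.+1.
have E (u v : fps R) i : (i < k.+1)%N -> fps_coef (fps_mul u v) i = (t u * t v)`_i.
  exact: fps_mulE.
transitivity (t f * (t g * t h))`_k; last rewrite mulrA.
  rewrite E // !coefM; apply: eq_bigr => i _; congr (_ * _).
  by rewrite coef_poly ltnS leq_subr E // ltnS leq_subr.
rewrite E // !coefM; apply: eq_bigr => i _; congr (_ * _).
by rewrite coef_poly ltn_ord E.
Qed.

Fact fps_mul1 (R : comNzRingType) : left_id (fps_one R) (@fps_mul R).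
Proof.
move=> f; apply: fpsP => k /=; rewrite big_ord_recl /= mul1r subn0.
by rewrite big1 ?addr0 // => i _; rewrite mul0r.
Qed.
Fact fps_mulDl (R : comNzRingType) : left_distributive (@fps_mul R) +%R.
Proof.
move=> f g h; apply: fpsP => k /=; rewrite -big_split /=.
by apply: eq_bigr => i _; rewrite mulrDl.
Qed.
Fact fps_one_neq0 (R : comNzRingType) : fps_one R != 0.
Proof. by apply/eqP => /(congr1 (fun f => fps_coef f 0%N)) /eqP; rewrite oner_eq0. Qed.

HB.instance Definition _ (R : comNzRingType) :=
  GRing.Zmodule_isComNzRing.Build (fps R)
    (@fps_mulA R) (@fps_mulC R) (@fps_mul1 R) (@fps_mulDl R) (@fps_one_neq0 R).

(* As everywhere in MathComp, [f^-1 = f] when [f] is not invertible. *)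
Definition fps_unit (R : comNzRingType) : pred (fps R) :=
  fun f => `[< exists g, g * f = 1 >].
Definition fps_inv (R : comNzRingType) (f : fps R) : fps R :=
  xget f [set g | g * f = 1].

Fact fps_mulV (R : comNzRingType) :
  {in @fps_unit R, left_inverse 1 (@fps_inv R) *%R}.
Proof. by move=> f /asboolP; apply: xgetPex. Qed.
Fact fps_unitPl (R : comNzRingType) (f g : fps R) : g * f = 1 -> fps_unit f.
Proof. by move=> gf; apply/asboolP; exists g. Qed.
Fact fps_inv_out (R : comNzRingType) :
  {in [predC @fps_unit R], @fps_inv R =1 id}.
Proof. by move=> f /asboolPn fN; rewrite /fps_inv xgetPN // => g gf; apply: fN; exists g. Qed.

HB.instance Definition _ (R : comNzRingType) :=
  GRing.ComNzRing_hasMulInverse.Build (fps R)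
    (@fps_mulV R) (@fps_unitPl R) (@fps_inv_out R).

Definition fps_X (R : comNzRingType) : fps R := Fps (fun k => (k == 1%N)%:R).

Lemma fps_coef1 (R : comNzRingType) k : fps_coef (1 : fps R) k = (k == 0%N)%:R.
Proof. by []. Qed.
Lemma fps_coefD (R : comNzRingType) (f g : fps R) k :
  fps_coef (f + g) k = fps_coef f k + fps_coef g k.
Proof. by []. Qed.
Lemma fps_coefN (R : comNzRingType) (f : fps R) k :
  fps_coef (- f) k = - fps_coef f k.
Proof. by []. Qed.
Lemma fps_coefM (R : comNzRingType) (f g : fps R) k :
  fps_coef (f * g) k = \sum_(i < k.+1) fps_coef f i * fps_coef g (k - i).
Proof. by []. Qed.
Lemma fps_coef_sum (R : comNzRingType) (I : Type) (r : seq I) (P : pred I)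
    (F : I -> fps R) k :
  fps_coef (\sum_(i <- r | P i) F i) k = \sum_(i <- r | P i) fps_coef (F i) k.
Proof. exact: (big_morph (fun f => fps_coef f k)). Qed.

Lemma fps_coefXn (R : comNzRingType) n k :
  fps_coef (fps_X R ^+ n) k = (k == n)%:R.
Proof.
elim: n k => [|n IH] k; first by rewrite expr0.
rewrite exprS fps_coefM; case: k => [|k].
  by rewrite big_ord_recl big_ord0 /= mul0r addr0.
rewrite big_ord_recl /= mul0r add0r big_ord_recl /= mul1r.
rewrite big1 => [|i _]; last by rewrite mul0r.
by rewrite addr0 IH /bump /= subSS subn0.
Qed.

(* Power series with constant coefficient 1 are invertible, so the integer
   powers of [1 + x^n] and [1 - x^n], [n >= 1], are the genuine ones. *)
Lemma fps_unit_coef1 (R : comNzRingType) (f : fps R) :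
  fps_coef f 0%N = 1 -> f \is a GRing.unit.
Proof.
move=> f0; have [h fE] : exists h, f = 1 - h by exists (1 - f); rewrite subKr.
have h0 : fps_coef h 0%N = 0.
  by rewrite -[h](subKr 1) -fE fps_coefD fps_coefN f0 subrr.
have hX m k : (k < m)%N -> fps_coef (h ^+ m) k = 0.
  elim: m k => // m IH k km; rewrite exprS fps_coefM big1 // => -[[|i] ik] _ /=.
    by rewrite h0 mul0r.
  by rewrite [fps_coef (h ^+ m) _]IH ?mulr0 //; lia.
pose s m := \sum_(i < m) h ^+ i.
have fs m : f * s m = 1 - h ^+ m.
  by rewrite fE -[in RHS](expr1n _ m) subrXX; congr (_ * _); apply: eq_bigr => i _;
     rewrite expr1n mul1r.
have s_stable m k : (k < m)%N -> fps_coef (s m) k = fps_coef (s k.+1) k.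
  elim: m => // m IH; rewrite ltnS leq_eqVlt => /predU1P[-> //|km].
  by rewrite /s big_ord_recr fps_coefD hX // addr0 IH.
pose g := Fps (fun k => fps_coef (s k.+1) k).
have fg : f * g = 1.
  apply: fpsP => k; transitivity (fps_coef (f * s k.+1) k).
    rewrite !fps_coefM; apply: eq_bigr => i _; congr (_ * _) => /=.
    by rewrite [RHS]s_stable // ltnS leq_subr.
  by rewrite fs fps_coefD fps_coefN hX // subr0.
by apply/asboolP; exists g; rewrite mulrC.
Qed.

Lemma fps_unit_1DXn (R : comNzRingType) n : (0 < n)%N ->
  1 + fps_X R ^+ n \is a GRing.unit.
Proof.
case: n => // n _; apply: fps_unit_coef1.
by rewrite fps_coefD fps_coefXn addr0.
Qed.

Lemma fps_unit_1BXn (R : comNzRingType) n : (0 < n)%N ->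
  1 - fps_X R ^+ n \is a GRing.unit.
Proof.
case: n => // n _; apply: fps_unit_coef1.
by rewrite fps_coefD fps_coefN fps_coefXn subr0.
Qed.

(* Convergence for the x-adic topology: each coefficient is eventually
   constant. *)
Definition fps_cvg (R : comNzRingType) (u : nat -> fps R) (S : fps R) : Prop :=
  forall k, exists N, forall M, (N <= M)%N -> fps_coef (u M) k = fps_coef S k.

(* [S] is the value of the infinite product of the [F n], [n >= 1]. *)
Definition fps_infprod (R : comNzRingType) (F : nat -> fps R) (S : fps R) : Prop :=
  fps_cvg (fun M => \prod_(1 <= n < M.+1) F n) S.

Definition is_intpart (s : seq nat) : bool := sorted geq s && (0%N \notin s).

Record intpart := IntPart { parts :> seq nat; _ : is_intpart parts }.
HB.instance Definition _ := [isSub for parts].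
HB.instance Definition _ := [Choice of intpart by <:].

Definition part_size (l : intpart) : nat := sumn l.

Definition partitions (n : nat) : set intpart := [set l | part_size l = n].

Lemma partitions_finite n : finite_set (partitions n).
Proof.
pose D := (fun s : seq 'I_n.+1 => insubd (@IntPart [::] isT) (map val s))
            @` range (fun b : n.-bseq 'I_n.+1 => val b).
apply: (@sub_finite_set _ _ D); last first.
  by do 2!apply: finite_image; exact: finite_finset.
move=> l; rewrite /partitions /part_size /= => ln.
have l0 : 0%N \notin (l : seq nat) by case: l {ln} => s /= /andP[].
have leM (s : seq nat) x : x \in s -> (x <= sumn s)%N.
  by move=> xs; rewrite sumnE (big_rem x) //= leq_addr.
have szM (s : seq nat) : 0%N \notin s -> (size s <= sumn s)%N.
  by elim: s => //= x s IH; rewrite inE negb_or => /andP[x0 /IH]; case: x x0 => //; lia.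
have sz : (size (map (@inord n) l) <= n)%N by rewrite size_map -[X in (_ <= X)%N]ln szM.
exists (map (@inord n) l); first by exists (Bseq sz).
rewrite -map_comp map_id_in => [|x xl /=]; first by apply: val_inj; rewrite val_insubd (valP l).
by rewrite inordK // ltnS -[X in (_ <= X)%N]ln leM.
Qed.

Definition num_partitions (n : nat) : nat := #|` fset_set (partitions n)|.

(* A type [tau] is indexed from 0: [tau i] is the partition attached to the
   multiplicity [i.+1].  Finiteness of the support is required explicitly since
   [\big[addn/0]_(i \in A) F i] is 0 by convention on infinite support. *)
Definition is_type (n : nat) (tau : nat -> intpart) : Prop :=
  finite_set [set i | parts (tau i) <> [::]] /\
  (\big[addn/0]_(i \in [set: nat]) (i.+1 * part_size (tau i)) = n)%N.

Lemma types_finite n : finite_set [set tau | is_type n tau].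
Proof.
pose e : intpart := @IntPart [::] isT.
pose U : set intpart := \bigcup_(m in [set m | (m <= n)%N]) partitions m.
have Ufin : finite_set U.
  apply: bigcup_finite => [|m _]; last exact: partitions_finite.
  by apply: (@sub_finite_set _ _ `I_n.+1) => // m /=; rewrite ltnS.
pose X := fset_set U.
pose h (f : {ffun 'I_n -> X}) (i : nat) : intpart :=
  if insub i is Some j then val (f j) else e.
apply: (@sub_finite_set _ _ (range h)); last first.
  by apply: finite_image; exact: finite_finset.
move=> tau [tau_fin tau_sum].
have szM i : (i.+1 * part_size (tau i) <= n)%N.
  have [->|i0] := eqVneq (i.+1 * part_size (tau i))%N 0%N; first by [].
  rewrite -tau_sum fsbig_supp (fsbigD1 i) ?leq_addr //=; last first.
    by split=> //; apply/eqP.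
  apply: sub_finite_set tau_fin => j [_] /=; apply: contra_not => jE.
  by rewrite /part_size jE muln0.
have Xtau i : tau i \in X.
  rewrite in_fset_set // inE; exists (part_size (tau i)) => //=.
  by have := szM i; apply: leq_trans; rewrite leq_pmull.
exists [ffun i : 'I_n => FSetSub (Xtau i)] => //; apply: funext => i.
rewrite /h; case: insubP => [j _ <-|]; first by rewrite ffunE.
rewrite -leqNgt => ni; apply: val_inj => /=.
have : part_size (tau i) = 0%N.
  by have := szM i; case: (part_size _) => // m; rewrite mulnS; lia.
rewrite /part_size; case: (tau i) => -[|x s] //= /andP[_].
by rewrite inE negb_or; case: x.
Qed.

Definition multiplicities (tau : nat -> intpart) : set nat :=
  [set i.+1 | i in [set i | parts (tau i) <> [::]]].

Definition pow2_types (n : nat) : set (nat -> intpart) :=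
  [set tau | is_type n tau /\ exists k, multiplicities tau = [set (2 ^ k)%N]].

Lemma pow2_types_finite n : finite_set (pow2_types n).
Proof. by apply: sub_finite_set (types_finite n) => tau []. Qed.

Definition num_pow2_types (n : nat) : nat := #|` fset_set (pow2_types n)|.

Definition A305841_identity (a : nat -> int) : Prop :=
  exists S : fps int,
    fps_infprod (fun n => (1 + fps_X int ^+ n) ^ a n) S /\
    fps_infprod (fun n => (1 - fps_X int ^+ n) ^- num_partitions n) S.

(* Main.v *)
(* Write 1 + x^n = (1 - x^(2n)) / (1 - x^n).  The left-hand product becomes the
   product of the (1 - x^n)^(a(n/2) - a(n)), with a(n/2) = 0 for odd n.  The
   exponents of such a product are determined by its value, hence
   a(n) = p(n) + a(n/2).  The numbers A(n) satisfy the same recurrence: the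
   single multiplicity of a type is either 1, or even and can be halved. *)
Require Import Defs.
From mathcomp Require Import all_boot all_algebra.
From mathcomp Require Import finmap zify ring.
From mathcomp Require Import boolp classical_sets cardinality fsbigop.

Set Implicit Arguments.
Unset Strict Implicit.
Unset Printing Implicit Defensive.

Import GRing.Theory.
Local Open Scope ring_scope.

(** * Congruences of power series modulo a power of x *)

Section TruncatedSeries.
Variable R : comNzRingType.
Implicit Types f g h : fps R.

Lemma fps_coefMz f (z : int) k : fps_coef (f *~ z) k = fps_coef f k *~ z.
Proof.
have pos (m : nat) : fps_coef (f *+ m) k = fps_coef f k *+ m.
  by elim: m => // m IH; rewrite !mulrS fps_coefD IH.
by case: z => m; [exact: pos | rewrite NegzE !mulrNz fps_coefN [X in - X]pos].
Qed.

Lemma fps_coefMXn f m k :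
  fps_coef (f * fps_X R ^+ m) k = if (k < m)%N then 0 else fps_coef f (k - m).
Proof.
rewrite fps_coefM; case: ltnP => [km|mk].
  rewrite big1 // => i _; rewrite fps_coefXn ltn_eqF ?mulr0 //.
  exact: leq_ltn_trans (leq_subr _ _) km.
have km : (k - m < k.+1)%N by rewrite ltnS leq_subr.
rewrite (bigD1 (Ordinal km)) //= fps_coefXn subKn // eqxx mulr1.
rewrite big1 ?addr0 // => i /eqP iN; rewrite fps_coefXn.
case: eqP => [ki|]; last by rewrite mulr0.
by case: iN; apply: val_inj => /=; have := ltn_ord i; lia.
Qed.

Definition fps_eqmod m f g := forall k, (k < m)%N -> fps_coef f k = fps_coef g k.

Lemma fps_eqmodM m f g f' g' :
  fps_eqmod m f g -> fps_eqmod m f' g' -> fps_eqmod m (f * f') (g * g').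
Proof.
move=> fg fg' k km; rewrite !fps_coefM; apply: eq_bigr => -[i ik] _ /=.
by rewrite fg ?fg' //; lia.
Qed.

Lemma fps_eqmodDMXn m f h : fps_eqmod m (f + h * fps_X R ^+ m) f.
Proof. by move=> k km; rewrite fps_coefD fps_coefMXn km addr0. Qed.

(** Modulo x^(n+1) the square of x^n vanishes, so the product of 1 - u x^n and 1 - v x^n is 1 - (u +
    v) x^n. Induction gives the natural powers, and inversion the negative ones. *)
Lemma fps_eqmodX1BXn n (z : int) : (0 < n)%N ->
  fps_eqmod n.+1 ((1 - fps_X R ^+ n) ^ z) (1 - fps_X R ^+ n *~ z).
Proof.
move=> n0; set x := fps_X R ^+ n.
have ux : 1 - x \is a GRing.unit by apply: fps_unit_1BXn.
(* As n > 0, x^(2n) is a multiple of x^(n+1). *)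
have xx : x * x = fps_X R ^+ n.-1 * fps_X R ^+ n.+1.
  by rewrite -!exprD; congr (_ ^+ _); lia.
have mulx (u v : int) : fps_eqmod n.+1 ((1 - x *~ u) * (1 - x *~ v))
                                       (1 - x *~ (u + v)).
  suff -> : (1 - x *~ u) * (1 - x *~ v) =
    1 - x *~ (u + v) + (fps_X R ^+ n.-1 *~ (u * v)) * fps_X R ^+ n.+1.
    exact: fps_eqmodDMXn.
  rewrite mulrzAl -xx mulrzDr mulrzA -mulrzAr -mulrzAl.
  by ring.
have pos (m : nat) : fps_eqmod n.+1 ((1 - x) ^+ m) (1 - x *~ m%:Z).
  elim: m => [|m IH]; first by rewrite mulr0z subr0.
  move=> k kn; rewrite exprS (fps_eqmodM (g := 1 - x) (fun _ _ => erefl) IH) //.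
  by rewrite -[X in (1 - X) * _]mulr1z mulx // -[m.+1%:Z]add1n PoszD.
case: z => m; first exact: pos.
rewrite NegzE -exprnN => k kn; set y := (1 - x) ^+ m.+1.
have uy : y \is a GRing.unit by rewrite unitrX.
(* The factor 1 is replaced by [y * (1 - x *~ - m.+1%:Z)], congruent to it, and [y] cancels. *)
rewrite -[y^-1]mulr1.
have yV : fps_eqmod n.+1 (y * (1 - x *~ - m.+1%:Z)) 1.
  move=> j jn; rewrite (fps_eqmodM (pos m.+1) (fun _ _ => erefl)) //.
  by rewrite mulx // subrr mulr0z subr0.
rewrite -(fps_eqmodM (f := y^-1) (fun _ _ => erefl) yV) //.
by rewrite mulrA mulVr // mul1r.
Qed.

End TruncatedSeries.

(** * Products of integer powers of 1 - x^n and their exponents *)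

Section EulerProducts.
Variable R : comNzRingType.
Implicit Types c d : nat -> int.

Definition euler_prod c M : fps R :=
  \prod_(1 <= n < M.+1) (1 - fps_X R ^+ n) ^ c n.

Lemma euler_prodS c M :
  euler_prod c M.+1 = euler_prod c M * (1 - fps_X R ^+ M.+1) ^ c M.+1.
Proof. by rewrite /euler_prod big_nat_recr. Qed.

(** Each factor of index above k is 1 modulo x^(k+1). *)
Lemma euler_prod_eqmod c k M : (k <= M)%N ->
  fps_eqmod k.+1 (euler_prod c M) (euler_prod c k).
Proof.
elim: M => [|M IH]; first by rewrite leqn0 => /eqP ->.
rewrite leq_eqVlt => /predU1P[->//|kM] j jk.
rewrite euler_prodS (fps_eqmodM (IH kM) (g' := 1)) ?mulr1 // => i ik.
have iM : (i < M.+1)%N := leq_trans ik kM.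
rewrite (fps_eqmodX1BXn _ _ (ltn0Sn M) (ltnW iM)) fps_coefD fps_coefN fps_coefMz fps_coefXn.
by rewrite ltn_eqF // mul0rz subr0.
Qed.

Lemma euler_prodD c d M :
  euler_prod (fun n => c n + d n) M = euler_prod c M * euler_prod d M.
Proof.
rewrite /euler_prod -big_split; apply: eq_big_nat => n /andP[n0 _].
by rewrite exprzDr // fps_unit_1BXn.
Qed.

Lemma euler_prod_coef0 c M : fps_coef (euler_prod c M) 0%N = 1.
Proof.
rewrite (@euler_prod_eqmod c 0) //.
by rewrite /euler_prod big_nil.
Qed.

(** The exponents after substituting x^2 for x in the product. *)
Definition dilate2 c n : int := if odd n then 0 else c n./2.

Lemma euler_prod_dilate2 c M :
  euler_prod (dilate2 c) M.*2 =
  \prod_(1 <= n < M.+1) (1 - fps_X R ^+ n.*2) ^ c n.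
Proof.
elim: M => [|M IH]; first by rewrite /euler_prod !big_nil.
rewrite big_nat_recr //= -IH doubleS !euler_prodS.
by rewrite /dilate2 /= odd_double /= doubleK expr0z mulr1.
Qed.

Lemma prodX1DXn c M :
  \prod_(1 <= n < M.+1) (1 + fps_X R ^+ n) ^ c n =
  euler_prod (dilate2 c) M.*2 * euler_prod (fun n => - c n) M.
Proof.
rewrite euler_prod_dilate2 /euler_prod -big_split; apply: eq_big_nat => n /andP[n0 _] /=.
have u := fps_unit_1BXn R n0.
have -> : 1 - fps_X R ^+ n.*2 = (1 + fps_X R ^+ n) * (1 - fps_X R ^+ n).
  by rewrite -addnn exprD; ring.
rewrite exprMz_comm ?fps_unit_1DXn //; last exact: mulrC.
by rewrite -mulrA -exprzDr // subrr expr0z mulr1.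
Qed.

End EulerProducts.

(** Once the exponents up to n agree, the coefficient of x^(n+1) reveals the next one: the products
    have constant term 1, so the factor of index n+1 lowers this coefficient by exactly its
    exponent. *)
Lemma euler_prod_inj (c d : nat -> int) :
  (forall k, fps_coef (euler_prod int c k) k = fps_coef (euler_prod int d k) k) ->
  forall n, (0 < n)%N -> c n = d n.
Proof.
move=> cd; elim/ltn_ind => -[//|n] IH _; have := cd n.+1; rewrite !euler_prodS.
have <- : euler_prod int c n = euler_prod int d n.
  by apply: eq_big_nat => j /andP[j0 jn]; rewrite IH.
set P := euler_prod int c n.
have E (z : int) :
    fps_coef (P * (1 - fps_X int ^+ n.+1) ^ z) n.+1 = fps_coef P n.+1 - z.
  rewrite (fps_eqmodM (fun _ _ => erefl) (fps_eqmodX1BXn _ z (ltn0Sn n))) //.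
  rewrite mulrBr mulr1 mulrzAr fps_coefD fps_coefN fps_coefMz fps_coefMXn ltnn.
  by rewrite subnn euler_prod_coef0 intz.
by rewrite !E; lia.
Qed.

Lemma A305841_recurrence (a : nat -> int) : A305841_identity a ->
  forall n, (0 < n)%N ->
  a n = (num_partitions n)%:Z + (if odd n then 0 else a n./2).
Proof.
case=> S [cvgL cvgR] n n0.
suff : dilate2 a n - a n = - (num_partitions n)%:Z by rewrite /dilate2; lia.
apply: (@euler_prod_inj (fun n => dilate2 a n - a n)
         (fun n => - (num_partitions n)%:Z)) n0 => k.
have [N1 HL] := cvgL k; have [N2 HR] := cvgR k.
(* At this length both partial products have the k-th coefficient of [S], and cutting them back to
   length k keeps it. *)
pose M := maxn k (maxn N1 N2).
have kM : (k <= M)%N by rewrite leq_maxl.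
have N1M : (N1 <= M)%N by rewrite !leq_max leqnn orbT.
have N2M : (N2 <= M)%N by rewrite !leq_max leqnn !orbT.
rewrite euler_prodD -(@euler_prod_eqmod _ (fun n => - _%:Z) k M) //.
transitivity (fps_coef S k).
  rewrite -(HL M) // prodX1DXn.
  (* The two products have lengths [M.*2] and [M], both at least k. *)
  apply: esym; apply: (@fps_eqmodM _ k.+1) => //; apply: euler_prod_eqmod; lia.
rewrite -(HR M) //; congr (fps_coef _ _); apply: eq_bigr => i _.
by rewrite exprnN.
Qed.

(** * Types whose single multiplicity is a power of 2 *)

Local Open Scope classical_set_scope.

Definition empty_part : intpart := @IntPart [::] isT.

Definition pow2_type k (l : intpart) (i : nat) : intpart :=
  if i.+1 == (2 ^ k)%N then l else empty_part.

Lemma pow2_type_sum k l :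
  (\big[addn/0]_(i \in [set: nat]) (i.+1 * part_size (pow2_type k l i)) =
   2 ^ k * part_size l)%N.
Proof.
have k0 : ((2 ^ k).-1.+1 = 2 ^ k)%N by rewrite prednK ?expn_gt0.
rewrite -(fsbig_widen [set (2 ^ k).-1]) //.
  by rewrite fsbig_set1 /pow2_type k0 eqxx.
move=> i [_ /= iN]; rewrite /pow2_type; case: eqP => [ik|_]; last by rewrite muln0.
by case: iN; rewrite -ik.
Qed.

(** Positivity of n forces [l] to be nonempty, so that 2^k really occurs as a multiplicity. *)
Lemma pow2_typesP n tau : (0 < n)%N ->
  pow2_types n tau <->
  exists k l, tau = pow2_type k l /\ (2 ^ k * part_size l)%N = n.
Proof.
move=> n0; split=> [[[_ tau_sum] [k tau_k]]|[k [l [-> kl]]]].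
  have tauE : tau = pow2_type k (tau (2 ^ k).-1).
    apply: funext => i; rewrite /pow2_type; case: eqP => [<-//|ik].
    apply: val_inj => /=; apply: contrapT => tau_i; apply: ik.
    suff : multiplicities tau i.+1 by rewrite tau_k.
    by exists i.
  by exists k, (tau (2 ^ k).-1); split=> //; rewrite -pow2_type_sum -tauE.
have k0 : ((2 ^ k).-1.+1 = 2 ^ k)%N by rewrite prednK ?expn_gt0.
have l0 : parts l <> [::] by move=> l0; move: n0; rewrite -kl /part_size l0 muln0.
have supp i : parts (pow2_type k l i) <> [::] -> i.+1 = (2 ^ k)%N.
  by rewrite /pow2_type; case: eqP.
split; first split; last exists k.
- apply: (@sub_finite_set _ _ [set (2 ^ k).-1]) => [i /= /supp <- //|].
  exact: finite_set1.
- by rewrite pow2_type_sum.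
- apply/seteqP; split=> [_ [i /supp /= -> <-] //|_ /= ->].
  by exists (2 ^ k).-1 => //=; rewrite /pow2_type k0 eqxx.
Qed.

(** Doubles every multiplicity. Index i stands for i+1, which is even when i is odd; its half then
    has index [i./2]. *)
Definition double_type (tau : nat -> intpart) (i : nat) : intpart :=
  if odd i then tau i./2 else empty_part.

Lemma double_pow2_type k l : double_type (pow2_type k l) = pow2_type k.+1 l.
Proof.
apply: funext => i; rewrite /double_type /pow2_type expnS mul2n.
have := odd_double_half i; case: (odd i) => iE.
  by rewrite -{2}iE -doubleS (inj_eq double_inj).
by case: eqP => // /(congr1 odd) /=; rewrite odd_double -iE add0n odd_double.
Qed.

(** The case k = 0 gives the first set; k > 0 forces n to be even and gives the second. *)
Lemma pow2_types_rec n : (0 < n)%N ->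
  pow2_types n = pow2_type 0 @` partitions n `|`
    (if odd n then set0 else double_type @` pow2_types n./2).
Proof.
move=> n0; have nE := odd_double_half n; apply/seteqP; split=> tau.
  move=> /(pow2_typesP _ n0) [[|k] [l [-> kl]]].
    by left; exists l; rewrite // /partitions /= -kl mul1n.
  move: kl; rewrite expnS -mulnA mul2n => kl.
  right; rewrite -kl odd_double doubleK.
  exists (pow2_type k l); last exact: double_pow2_type.
  by apply/pow2_typesP; [lia | exists k, l].
case=> [[l ln <-]|]; first by apply/pow2_typesP => //; exists 0%N, l; rewrite mul1n.
case: (odd n) nE => // nE [sigma + <-].
move=> /(pow2_typesP _ _)[|k [l [-> kl]]]; first by lia.
apply/pow2_typesP => //; exists k.+1, l; split; first exact: double_pow2_type.
by rewrite expnS -mulnA kl; lia.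
Qed.

Lemma num_pow2_types_rec n : (0 < n)%N ->
  num_pow2_types n =
  (num_partitions n + if odd n then 0 else num_pow2_types n./2)%N.
Proof.
move=> n0; rewrite /num_pow2_types pow2_types_rec //.
have finP : finite_set (pow2_type 0 @` partitions n).
  exact/finite_image/partitions_finite.
have cardP : #|` fset_set (pow2_type 0 @` partitions n)| = num_partitions n.
  rewrite fset_set_image; last exact: partitions_finite.
  by rewrite card_imfset // => l l' /(congr1 (fun tau => tau 0%N)).
case: ifP => _; first by rewrite setU0 cardP addn0.
have finD : finite_set (double_type @` pow2_types n./2).
  exact/finite_image/pow2_types_finite.
(* A doubled type is empty at index 0, so a common element would come from the empty partition,
   against n > 0. *)
have disj : pow2_type 0 @` partitions n `&` double_type @` pow2_types n./2 = set0.
  apply/seteqP; split=> // tau [[l ln <-] [sigma _ /(congr1 (fun tau => tau 0%N))]].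
  by rewrite /double_type /pow2_type /= => l0; move: ln n0; rewrite -l0 => <-.
have cardD : #|` fset_set (double_type @` pow2_types n./2)| = num_pow2_types n./2.
  rewrite fset_set_image; last exact: pow2_types_finite.
  rewrite card_imfset // => sigma sigma' E; apply: funext => i.
  (* Doubling is injective: [sigma i] reappears at index 2i+1. *)
  move/(congr1 (fun tau => tau i.*2.+1)): E.
  by rewrite /double_type /= odd_double /= uphalf_double.
rewrite -cardP -[X in (_ + X)%N]cardD -cardfsUI -fset_setI // disj.
by rewrite fset_set0 cardfs0 addn0 fset_setU.
Qed.

Theorem proposition58 (a : nat -> int) :
  A305841_identity a ->
  forall n : nat, (1 <= n)%N -> ((num_pow2_types n)%:Z = a n)%R.
Proof.
move=> /A305841_recurrence aE; elim/ltn_ind => n IH n0.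
rewrite aE // num_pow2_types_rec // PoszD; congr (_ + _).
(* For even n > 0, [n./2] is positive and smaller than n. *)
by have := odd_double_half n; case: ifP => // _ nE; apply: IH; lia.
Qed.
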